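(* Let $a_1,a_2$ be integers with $a_2\ne0$, $\gcd(a_1,a_2)=1$, and let $\{u_n\}_{n\ge0}$ be the Lucas sequence $u_0=0$, $u_1=1$, $u_{n+2}=a_1u_{n+1}+a_2u_n$, whose characteristic polynomial $X^2-a_1X-a_2$ has distinct roots $\alpha_1,\alpha_2$ with $\alpha_1/\alpha_2$ not a root of unity. Suppose $\Delta_u:=a_1^2+4a_2\ne 1$. Then there exist positive constants $c_1$ and $x_0$ (depending on the sequence) such that for all $x>x_0$, $$\#\{n\le x:\ n\mid u_n\}>\exp\left(c_1(\log\log x)^2\right).$$
   Context: $\Delta_u=(\alpha_1-\alpha_2)^2=a_1^2+4a_2$ is the discriminant of the characteristic polynomial. *)

(* Defs.v *)
From HB Require Import structures.
From mathcomp Require Import all_boot all_order all_algebra all_field.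
From mathcomp Require Import reals.

Set Implicit Arguments.
Unset Strict Implicit.
Unset Printing Implicit Defensive.

Import Order.TTheory GRing.Theory Num.Theory.

Local Open Scope ring_scope.

Definition lucas_seq (a1 a2 : int) (u : nat -> int) : Prop :=
  [/\ u 0%N = 0, u 1%N = 1
    & forall n : nat, u n.+2 = a1 * u n.+1 + a2 * u n].

Definition lucas_charpoly (a1 a2 : int) : {poly int} :=
  'X^2 - a1 *: 'X - a2%:P.

Definition lucas_discr (a1 a2 : int) : int := a1 ^+ 2 + 4 * a2.

(* The number of positive integers n <= x with n | u n. The index 0 is left
   out, since 0 %| u 0 = 0 holds trivially. For x >= 0 the bound
   n <= Num.truncn x is equivalent to n%:R <= x (truncn_ge_nat). *)
Definition count_self_dvd (R : realType) (u : nat -> int) (x : R) : nat :=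
  #|[set n : 'I_(Num.truncn x).+1 | (0 < n)%N && (n%:Z %| u n)%Z]|.

(* Main.v *)
(* Let r be a prime dividing the discriminant. Since u_{km}/u_m is congruent to
   k u_{m+1}^(k-1) modulo u_m, each power r^i divides u_{r^i}, and n | u_n and
   q | u_n imply nq | u_{nq}. The same congruence shows that r is the only prime
   that can divide both u_{rm}/u_m and u_m for m = r^i, and only to the first
   power, so u_{rm} has a prime factor not dividing u_m as soon as
   |u_{rm}| > r |u_m|. No deep lower bound on |u_n| is needed for this: if the
   inequality fails at m, then the r m-th powers of the two roots are so close
   that it holds at r m. Hence, with R = r^2, for all large j some prime q_j
   divides u_{R^(j+1)} but not u_{R^j}; trivially q_j <= C^(R^(j+1)). The
   R^(K^2) products R^(j0+K) q_{j0}^e_0 ... q_{j0+K-1}^e_{K-1} with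
   0 <= e_i < R^K are distinct, satisfy n | u_n, and are at most D^(R^(2K)) for
   a constant D; taking K proportional to log log x gives the bound. *)
Require Import Defs.
From HB Require Import structures.
From mathcomp Require Import all_boot all_order all_algebra all_field.
From mathcomp Require Import reals sequences exp.
From mathcomp Require Import ring lra zify.

Set Implicit Arguments.
Unset Strict Implicit.
Unset Printing Implicit Defensive.

Import Order.TTheory GRing.Theory Num.Theory.

Local Open Scope ring_scope.

(** * Divisibility and prime divisors in a Lucas sequence *)

Section LucasArithmetic.

Variables (a1 a2 : int) (u : nat -> int).
Hypothesis lucas_u : lucas_seq a1 a2 u.

(** This is one entry of [M ^ (m + n) = M ^ m * M ^ n] for the companion matrix [M]. *)
Lemma lucas_addn m n : u (m + n).+1 = u m.+1 * u n.+1 + a2 * u m * u n.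
Proof.
have [u0 u1 uS] := lucas_u.
suff : u (m + n).+1 = u m.+1 * u n.+1 + a2 * u m * u n
    /\ u (m + n).+2 = u m.+1 * u n.+2 + a2 * u m * u n.+1 by case.
elim: n => [|n [IH1 IH2]]; first by rewrite addn0 !uS u0 u1; split; ring.
by rewrite addnS IH2; split=> //; rewrite uS IH2 IH1 (uS n.+1) (uS n); ring.
Qed.

(* Modulo [u m] the companion matrix to the power [m] is the scalar matrix
   [u m.+1], which is why its powers control the multiples of [m]. *)
Lemma lucas_muln m k : (0 < m)%N -> exists w : int,
  u (m * k) = u m * w /\ (u m %| w - k%:R * u m.+1 ^+ k.-1)%Z.
Proof.
have [u0 u1 uS] := lucas_u.
case: m => // m _; set s := u m.+2.
suff [w [t [z [Ew _ Ez]]]] : exists w t z : int,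
    [/\ u (m.+1 * k)%N = u m.+1 * w, u (m.+1 * k).+1 = s ^+ k + u m.+1 * t
      & w = k%:R * s ^+ k.-1 + z * u m.+1].
  by exists w; split=> //; apply/dvdzP; exists z; rewrite Ez; ring.
elim: k => [|k [w [t [z [Ew Et Ez]]]]].
  by exists 0, 0, 0; rewrite muln0 u0 u1; split; ring.
exists (u (m.+1 * k).+1 + a2 * w * u m), (t * s + a2 * w * u m.+1),
  (t + s * z - a1 * w); rewrite mulnSr; split.
- by rewrite addnS lucas_addn Ew; ring.
- by rewrite lucas_addn Ew Et exprS -/s; ring.
(* The recurrence makes [a2 * u m] congruent to [s] modulo [u m.+1], so the new quotient gains one
   more term [s ^+ k]. *)
- have -> : a2 * w * u m = s * w - a1 * w * u m.+1 by rewrite /s uS; ring.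
  rewrite Et {1}Ez -[k.+1]addn1 natrD addn1 /=.
  by case: k {Ew Et Ez} => [|k]; rewrite ?exprS /=; ring.
Qed.

Lemma lucas_dvd_muln m k : (u m %| u (m * k))%Z.
Proof.
have [u0 _ _] := lucas_u.
case: m => [|m]; first by rewrite mul0n u0.
by have [w [-> _]] := lucas_muln k (ltn0Sn m); exact: dvdz_mulr.
Qed.

(** Since [q] divides [u n], the congruence of [lucas_muln] for the quotient of [u (n * q)] by [u n]
    shows that [q] divides this quotient. *)
Lemma self_dvd_mul n q : (n%:Z %| u n)%Z -> (q%:Z %| u n)%Z ->
  ((n * q)%N%:Z %| u (n * q))%Z.
Proof.
have [u0 _ _] := lucas_u.
case: n => [|n] dvd_n dvd_q; first by rewrite mul0n u0.
have [w [-> dvd_w]] := lucas_muln q (ltn0Sn n).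
rewrite PoszM; apply: dvdz_mul => //.
by have := dvdz_trans dvd_q dvd_w; rewrite rpredBr ?dvdz_mulr ?natz ?dvdzz.
Qed.

(** Modulo the discriminant the characteristic polynomial has the double root [a1 / 2], so [u n.+1]
    behaves like [n.+1] times its [n]-th power; the factor [2 ^+ n] clears denominators. *)
Lemma lucas_discr_dvd n :
  (lucas_discr a1 a2 %| 2 ^+ n * u n.+1 - n.+1%:R * a1 ^+ n)%Z.
Proof.
have [u0 u1 uS] := lucas_u.
suff [_ //] :
  (lucas_discr a1 a2 %| 2 ^+ n.+1 * u n.+2 - n.+2%:R * a1 ^+ n.+1)%Z
  /\ (lucas_discr a1 a2 %| 2 ^+ n * u n.+1 - n.+1%:R * a1 ^+ n)%Z.
elim: n => [|n [/dvdzP[y Ey] /dvdzP[z Ez]]].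
  by rewrite uS u0 u1; split; apply/dvdzP; exists 0; ring.
split; apply/dvdzP; last by exists y.
exists (2 * a1 * y - a1 ^+ 2 * z + 2 ^+ n * u n.+1).
have -> : 2 ^+ n.+2 * u n.+3 = 2 * a1 * (2 ^+ n.+1 * u n.+2)
   + (lucas_discr a1 a2 - a1 ^+ 2) * (2 ^+ n * u n.+1).
  by rewrite uS /lucas_discr !exprS; ring.
move/eqP: Ey; rewrite subr_eq => /eqP ->.
have -> : 2 ^+ n * u n.+1 = z * lucas_discr a1 a2 + n.+1%:R * a1 ^+ n.
  by rewrite -Ez; ring.
by rewrite !exprS; ring.
Qed.

Section PrimeDiscr.
Variable r : nat.
Hypotheses (r_prime : prime r) (r_discr : (r%:Z %| lucas_discr a1 a2)%Z).

Lemma prime_discr_dvd_lucas : (r%:Z %| u r)%Z.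
Proof.
have [u0 u1 uS] := lucas_u.
have [r2|r_odd] := even_prime r_prime.
  move: r_discr; rewrite r2 uS u1 u0 /lucas_discr.
  rewrite mulr0 addr0 mulr1 rpredDr; last exact: (@dvdz_mulr _ 4).
  by rewrite !dvdzE abszX Euclid_dvdX // andbT.
have := dvdz_trans r_discr (lucas_discr_dvd r.-1).
rewrite prednK ?prime_gt0 // rpredBr; last by rewrite natz dvdz_mulr ?dvdzz.
rewrite Gauss_dvdzr // coprimezXr // coprimezE /=.
by rewrite coprime_sym coprime2n.
Qed.

Lemma expn_self_dvd i : ((r ^ i)%N%:Z %| u (r ^ i))%Z.
Proof.
have [_ u1 _] := lucas_u.
have r1 := prime_discr_dvd_lucas.
case: i => [|i]; first by rewrite expn0 u1.
elim: i => [|i IH]; first by rewrite expn1.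
rewrite expnSr; apply: self_dvd_mul => //.
apply: dvdz_trans r1 _; rewrite expnS; exact: lucas_dvd_muln.
Qed.

End PrimeDiscr.

Hypothesis coprime_a : gcdz a1 a2 = 1.

Lemma lucas_coprime_a2 n : coprimez (u n.+1) a2.
Proof.
have [u0 u1 uS] := lucas_u.
elim: n => [|n IH]; first by rewrite u1 coprimezE coprime1n.
rewrite uS /coprimez gcdzC addrC [a2 * _]mulrC gcdzMDl.
rewrite -/(coprimez _ _) coprimezMr [X in _ && X]coprimez_sym IH andbT.
by rewrite /coprimez gcdzC coprime_a.
Qed.

Lemma lucas_coprime n : coprimez (u n) (u n.+1).
Proof.
have [u0 u1 uS] := lucas_u.
elim: n => [|n IH]; first by rewrite u0 u1 coprimezE coprimen1.
rewrite uS /coprimez gcdzMDl -/(coprimez _ _) coprimezMr lucas_coprime_a2.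
by rewrite coprimez_sym.
Qed.

(** The quotient [w] of [u (m * r)] by [u m] is [r * k] with [k] of absolute value above 1. A prime
    [p] of [k] dividing [u m] would divide [r * s ^+ r.-1], with [s] coprime to [u m], so [p = r].
    Then [r ^ 2] would divide [w], which is [r * s ^+ r.-1] modulo [r ^ 2]: a contradiction. *)
Lemma lucas_new_prime r m : prime r -> (0 < m)%N -> (m%:Z %| u m)%Z ->
  ((r ^ 2) %| m)%N -> u m != 0 -> r%:Z * `|u m| < `|u (m * r)| ->
  exists p : nat, [/\ prime p, (p%:Z %| u (m * r))%Z & ~~ (p%:Z %| u m)%Z].
Proof.
move=> r_prime m_gt0 dvd_m r2m um0 um_lt.
have [w [Ew dvd_w]] := lucas_muln r m_gt0; set s := u m.+1 in dvd_w.
have um_s p : prime p -> (p%:Z %| u m)%Z -> ~~ (p%:Z %| s ^+ r.-1)%Z.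
  move=> p_prime pu; apply/negP=> /(conj pu)/andP.
  rewrite -dvdz_gcd (eqP (coprimezXr _ (lucas_coprime m))) dvdz1 /=.
  by apply/negP; rewrite neq_ltn prime_gt1 ?orbT.
have r2u : ((r ^ 2)%N%:Z %| u m)%Z by exact: dvdz_trans dvd_m.
have ru : (r%:Z %| u m)%Z by apply: dvdz_trans r2u; rewrite dvdzE /= dvdn_mulr.
have rw : (r%:Z %| w)%Z.
  by have := dvdz_trans ru dvd_w; rewrite rpredBr ?dvdz_mulr ?natz ?dvdzz.
have /dvdzP[k Ek] := rw.
have k_gt1 : (1 < `|k|)%N.
  move: um_lt; rewrite Ew normrM mulrC ltr_pM2l ?normr_gt0 // Ek normrM.
  by rewrite [X in _ * X]ger0_norm // ltr_pMl ?ltz_nat ?prime_gt0 // -abszE.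
have pk : ((pdiv `|k|)%:Z %| k)%Z by rewrite dvdzE /= pdiv_dvd.
have p_prime := pdiv_prime k_gt1; move: (pdiv _) => p in pk p_prime *.
have pw : (p%:Z %| w)%Z by rewrite Ek dvdz_mulr.
exists p; split=> //; first by rewrite Ew dvdz_mull.
apply/negP => pu; have := dvdz_trans pu dvd_w; rewrite rpredBl // natz => prs.
have [Epr|pr] := eqVneq p r; last first.
  move: prs; rewrite Gauss_dvdzr; first by apply/negP/um_s.
  by rewrite coprimezE /= prime_coprime // dvdn_prime2.
have : ((r ^ 2)%N%:Z %| w)%Z by rewrite Ek PoszM dvdz_mul // -Epr.
have := dvdz_trans r2u dvd_w; rewrite natz => r2 r2w; move: r2.
rewrite rpredBl // PoszM dvdz_mul2l; first by apply/negP/um_s.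
by have := prime_gt0 r_prime; lia.
Qed.

Lemma lucas_bound n : `|u n| <= (1 + `|a1| + `|a2|) ^+ n.
Proof.
have [u0 u1 uS] := lucas_u.
suff [] : `|u n| <= (1 + `|a1| + `|a2|) ^+ n
     /\ `|u n.+1| <= (1 + `|a1| + `|a2|) ^+ n.+1 by [].
set C := 1 + _ + _.
have C1 : 1 <= C by rewrite /C -addrA lerDl addr_ge0.
elim: n => [|n [IH1 IH2]]; first by rewrite u0 u1 normr0 normr1 expr0.
split=> //; rewrite uS; apply: le_trans (ler_normD _ _) _; rewrite !normrM.
have Cn : `|a2| * `|u n| <= `|a2| * C ^+ n.+1.
  rewrite ler_wpM2l //; apply: le_trans IH1 _.
  by rewrite exprS ler_peMl // exprn_ge0 // (le_trans ler01).
have Cn1 : `|a1| * `|u n.+1| <= `|a1| * C ^+ n.+1 by rewrite ler_wpM2l.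
apply: le_trans (lerD Cn1 Cn) _; rewrite -mulrDl [leRHS]exprS ler_wpM2r //.
  by rewrite exprn_ge0 // (le_trans ler01).
by rewrite /C -addrA lerDr.
Qed.

End LucasArithmetic.

(** * Differences of powers of two nearby numbers *)

Section PowerDifferences.

Variable F : numFieldType.
Implicit Types a b : F.

Lemma norm_subXX_le M a b i : 0 <= M -> `|b| <= `|a| -> M * `|a - b| <= `|a| ->
  M * `|a ^+ i - b ^+ i| <= i%:R * `|a| ^+ i.
Proof.
move=> M_ge0 ba Mab; elim: i => [|i IH]; first by
  rewrite !expr0 subrr normr0 mulr0 mul0r.
have -> : a ^+ i.+1 - b ^+ i.+1 = a * (a ^+ i - b ^+ i) + (a - b) * b ^+ i.
  by rewrite !exprS; ring.
have le1 : M * `|a * (a ^+ i - b ^+ i)| <= `|a| * (i%:R * `|a| ^+ i).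
  by rewrite normrM mulrCA ler_wpM2l.
have le2 : M * `|(a - b) * b ^+ i| <= `|a| * `|a| ^+ i.
  by rewrite normrM mulrA normrX ler_pM ?mulr_ge0 ?exprn_ge0 ?lerXn2r ?nnegrE.
apply: le_trans (ler_wpM2l M_ge0 (ler_normD _ _)) _.
rewrite mulrDr; apply: le_trans (lerD le1 le2) _.
by rewrite [leRHS](_ : _ = `|a| * (i%:R * `|a| ^+ i) + `|a| * `|a| ^+ i) //
  exprS -natr1; ring.
Qed.

(** Replacing [b] by [a] turns the sum into [r%:R * a ^+ r.-1]; closeness keeps the error [T] to at
    most half of this, and [2 < |a|] absorbs the lost factor. *)
Lemma norm_sum_near a b r : (1 < r)%N -> `|b| <= `|a| -> 2 < `|a| ->
  (2 * r)%:R * `|a - b| <= `|a| ->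
  r%:R < `|\sum_(i < r) a ^+ (r.-1 - i) * b ^+ i|.
Proof.
move=> r_gt1 ba a_gt2 ab; have r_gt0 : (0 < r)%N by exact: ltnW.
have a_ge0 : 0 <= `|a| by [].
have a_gt1 : 1 < `|a| by apply: lt_trans a_gt2; rewrite ltr1n.
have nat_const_ord (c : F) : \sum_(i < r) c = r%:R * c.
  by rewrite sumr_const card_ord mulr_natl.
set T := \sum_(i < r) a ^+ (r.-1 - i) * (a ^+ i - b ^+ i).
have -> : \sum_(i < r) a ^+ (r.-1 - i) * b ^+ i = r%:R * a ^+ r.-1 - T.
  rewrite -nat_const_ord -sumrB; apply: eq_bigr => i _.
  rewrite mulrBr opprB addrCA -exprD subnK ?subrr ?addr0 //.
  by rewrite -ltnS prednK.
have T_le : 2 * `|T| <= r%:R * `|a| ^+ r.-1.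
  apply: le_trans (ler_wpM2l _ (ler_norm_sum _ _ _)) _ => //.
  rewrite mulr_sumr -nat_const_ord.
  apply: ler_sum => i _; rewrite normrM normrX mulrCA.
  have -> : `|a| ^+ r.-1 = `|a| ^+ (r.-1 - i) * `|a| ^+ i.
    by rewrite -exprD subnK // -ltnS prednK.
  rewrite ler_wpM2l ?exprn_ge0 //.
  have := norm_subXX_le i (ler0n _ _) ba ab.
  rewrite mulnC natrM -mulrA => /le_trans le.
  rewrite -(ler_pM2l (_ : 0 < r%:R)) ?ltr0n //; apply: le.
  by rewrite ler_wpM2r ?exprn_ge0 // ler_nat ltnW.
have : r%:R * 2 < r%:R * `|a| ^+ r.-1.
  rewrite ltr_pM2l ?ltr0n //; apply: lt_le_trans a_gt2 _.
  by rewrite -[leLHS]expr1 ler_weXn2l // ?ltW //; lia.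
have := lerB_dist (r%:R * a ^+ r.-1) T.
rewrite normrM normrX normr_nat => le lt.
apply: lt_le_trans le; rewrite -(ltr_pM2l (_ : 0 < 2)) ?ltr0n // mulrBr.
rewrite ltrBrDr; apply: le_lt_trans (lerD (lexx _) T_le) _.
by rewrite [2 * (_ * _)]mulr_natl mulr2n mulrC ltrD2r.
Qed.

(* If [a ^+ r] and [b ^+ r] are very close, then their [r]-th powers cannot be:
   their quotient is near [1] and the sum in [subrXX] has no cancellation. *)
Lemma subXX_growth a b r : (1 < r)%N -> `|b| <= `|a| ->
  (4 * r ^ 2)%:R <= `|a| -> a ^+ r != b ^+ r ->
  `|a ^+ r - b ^+ r| <= r%:R * `|a - b| ->
  r%:R * `|a ^+ r - b ^+ r| < `|a ^+ (r * r) - b ^+ (r * r)|.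
Proof.
move=> r_gt1 ba a_ge ab_neq close.
have a_gt2 : 2 < `|a| by apply: lt_le_trans a_ge; rewrite ltr_nat; nia.
have a_gt1 : 1 < `|a| by apply: lt_trans a_gt2; rewrite ltr1n.
have a2_le : `|a| ^+ 2 <= `|a ^+ r| by rewrite normrX ler_weXn2l // ltW.
rewrite !exprM (subrXX (a ^+ r)) mulrC normrM ltr_pM2l ?normr_gt0 ?subr_eq0 //.
apply: norm_sum_near => //.
- by rewrite !normrX lerXn2r ?nnegrE.
- apply: lt_le_trans a2_le; rewrite expr2; apply: lt_trans a_gt2 _.
  by rewrite ltr_pMl // (lt_trans ltr01).
(* The constant [4 * r ^ 2] comes from [2r |a^r - b^r| <= 2r^2 |a - b| <= 4r^2 |a| <= |a|^2]. *)
apply: le_trans a2_le; apply: le_trans (ler_wpM2l (ler0n _ _) close) _.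
have ab2 : `|a - b| <= 2 * `|a|.
  by apply: le_trans (ler_normB _ _) _; rewrite mulr_natl mulr2n lerD2l.
apply: le_trans (_ : (4 * r ^ 2)%:R * `|a| <= _);
  last by rewrite expr2 ler_wpM2r.
rewrite mulrA; apply: le_trans (ler_wpM2l _ ab2) _;
  first by rewrite -natrM ler0n.
by rewrite mulrA ler_wpM2r // -!natrM ler_nat; nia.
Qed.

End PowerDifferences.

(** * Roots of the characteristic polynomial and growth of the sequence *)

Lemma bernoulli_ineq (F : numDomainType) (x : F) n :
  0 <= x -> 1 + x *+ n <= (1 + x) ^+ n.
Proof.
move=> x_ge0; elim: n => [|n IH]; first by rewrite mulr0n addr0 expr0.
have x1 : 0 <= 1 + x by rewrite addr_ge0.
rewrite exprS; apply: le_trans (ler_wpM2l x1 IH).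
rewrite mulrDl mul1r mulrDr mulr1 -addrA lerD2l [leRHS]addrA mulrSr lerDl.
by rewrite mulr_ge0 ?mulrn_wge0.
Qed.

Lemma unbounded_expr (F : archiNumFieldType) (x y : F) : 1 < x -> 0 <= y ->
  exists n0, forall n, (n0 <= n)%N -> y <= x ^+ n.
Proof.
move=> x_gt1 y_ge0; have d_gt0 : 0 < x - 1 by rewrite subr_gt0.
exists (Num.bound (y / (x - 1))) => n le_n.
have := archi_boundP (divr_ge0 y_ge0 (ltW d_gt0)).
rewrite ltr_pdivrMr // => lt_y; apply: (le_trans (ltW lt_y)).
have := bernoulli_ineq n (ltW d_gt0); rewrite [1 + (x - 1)]addrC subrK;
  apply: le_trans.
apply: le_trans (_ : (x - 1) *+ n <= _); last by rewrite lerDr.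
by rewrite mulr_natl ler_wpMn2l // ltW.
Qed.

Lemma lucas_roots (a1 a2 : int) (x y : algC) :
  map_poly intr (lucas_charpoly a1 a2) = ('X - x%:P) * ('X - y%:P) ->
  x + y = a1%:~R /\ x * y = - a2%:~R.
Proof.
move=> E; have ev z : z ^+ 2 - a1%:~R * z - a2%:~R = (z - x) * (z - y).
  have := congr1 (horner^~ z) E.
  by rewrite /lucas_charpoly !rmorphB /= map_polyXn map_polyZ map_polyX
    map_polyC /=
    !hornerE.
(* The values at 0 and 1 determine the product and the sum of the roots. *)
have E0 := ev 0; have E1 := ev 1.
have xy : x * y = - a2%:~R.
  by rewrite -[x * y]mulrNN -[- x]sub0r -[- y]sub0r -E0; ring.
split=> //; have -> : x + y = 1 + x * y - (1 - x) * (1 - y) by ring.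
by rewrite -E1 xy; ring.
Qed.

Lemma lucas_binet (a1 a2 : int) (u : nat -> int) (x y : algC) n :
  lucas_seq a1 a2 u -> x + y = a1%:~R -> x * y = - a2%:~R ->
  (u n)%:~R * (x - y) = x ^+ n - y ^+ n.
Proof.
move=> [u0 u1 uS] sum prod.
suff [] : (u n)%:~R * (x - y) = x ^+ n - y ^+ n
  /\ (u n.+1)%:~R * (x - y) = x ^+ n.+1 - y ^+ n.+1 by [].
elim: n => [|n [IH1 IH2]]; first by rewrite u0 u1; split; ring.
split=> //; rewrite uS rmorphD !rmorphM /= mulrDl -!mulrA IH1 IH2 -sum.
by rewrite -[a2%:~R]opprK -prod !exprS; ring.
Qed.

(* The elementary case of Kronecker's theorem: it excludes roots of modulus 1. *)
Lemma reciprocal_root_unity (t : int) (x : algC) :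
  `|t| <= 2 -> x ^+ 2 - t%:~R * x + 1 = 0 -> x ^+ 12 = 1.
Proof.
move=> t2 E; have x2 : x ^+ 2 = t%:~R * x - 1 by rewrite -[RHS]add0r -E; ring.
have x12 c : c = 1 \/ c = -1 -> x ^+ 3 = c -> x ^+ 12 = 1.
  by move=> c1 x3; rewrite (exprM x 3 4) x3; case: c1 => ->; ring.
have x3 : x ^+ 3 = t%:~R * x ^+ 2 - x by rewrite exprS {1}x2; ring.
have sqr_x1 c : (x - c) ^+ 2 = 0 -> x = c.
  by move/eqP; rewrite expf_eq0 /= subr_eq0 => /eqP.
(* These values of [t] give [x] of order 1, 6, 4, 3 and 2 respectively, and 12 is a common
   multiple. *)
have : t = 2 \/ t = 1 \/ t = 0 \/ t = -1 \/ t = -2 by lia.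
case=> [|[|[|[]]]] Et; rewrite Et in x2 x3.
- by rewrite (sqr_x1 1) ?expr1n // sqrrB x2; ring.
- by apply: (x12 (-1)); [right|rewrite x3 x2; ring].
- by rewrite (exprM x 2 6) x2; ring.
- by apply: (x12 1); [left|rewrite x3 x2; ring].
- rewrite (sqr_x1 (-1)); first by ring.
  by rewrite sqrrB x2; ring.
Qed.

Section Growth.

Variables (a1 a2 : int) (u : nat -> int) (x y : algC).
Hypotheses (lucas_u : lucas_seq a1 a2 u) (a2_neq0 : a2 != 0).
Hypotheses (sum_xy : x + y = a1%:~R) (prod_xy : x * y = - a2%:~R).
Hypothesis xy_neq : forall k, (0 < k)%N -> x ^+ k != y ^+ k.

(** The product of the moduli is [|a2| >= 1], so failure would put both roots on the unit circle
    with [a2] equal to 1 or -1. Their squares have product 1 and an integer sum of size at most 2,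
    hence are 12th roots of unity, against [xy_neq] at 24. Squaring removes the sign of [x * y]. *)
Lemma root_gt1 : `|y| <= `|x| -> 1 < `|x|.
Proof.
move=> yx; have norm_xy : `|x| * `|y| = `|a2|%:~R.
  by rewrite -normrM prod_xy normrN intr_norm.
have a2_ge1 : 1 <= `|a2|%:~R :> algC by rewrite ler1z; lia.
have x_ge1 : 1 <= `|x|.
  rewrite -(@ler_pXn2r _ 2) ?nnegrE // expr1n (le_trans a2_ge1) //.
  by rewrite -norm_xy expr2 ler_wpM2l.
rewrite lt_neqAle x_ge1 andbT; apply/eqP => x1.
have y1 : `|y| = 1.
  have y_ge1 : 1 <= `|y| by rewrite -[`|y|]mul1r [X in X * _]x1 norm_xy.
  by apply/le_anti; rewrite y_ge1 x1 yx.
have a21 : `|a2| = 1.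
  by apply: (@intr_inj algC); rewrite -norm_xy -x1 y1 mulr1.
have sq_prod : x ^+ 2 * y ^+ 2 = 1.
  rewrite -exprMn prod_xy; have [->|->] : a2 = 1 \/ a2 = -1 by lia.
    by rewrite sqrrN expr1n.
  by rewrite rmorphN1 opprK expr1n.
have sq_sum : x ^+ 2 + y ^+ 2 = (a1 ^+ 2 + 2 * a2)%:~R.
  rewrite rmorphD rmorphXn rmorphM /= -sum_xy -[a2%:~R]opprK -prod_xy; ring.
have t2 : `|a1 ^+ 2 + 2 * a2| <= 2.
  rewrite -(@ler_int algC) intr_norm -sq_sum (le_trans (ler_normD _ _)) //.
  by rewrite !normrX -x1 y1 !expr1n.
have /eqP[] := xy_neq (isT : (0 < 24)%N).
rewrite !(exprM _ 2 12) !(reciprocal_root_unity t2) // -sq_sum -sq_prod; ring.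
Qed.

Lemma lucas_neq0 m : (0 < m)%N -> u m != 0.
Proof.
move=> m_gt0; apply: contra_neq (xy_neq m_gt0) => um0.
by apply/eqP; rewrite -subr_eq0 -(lucas_binet m lucas_u sum_xy prod_xy) um0
  mul0r.
Qed.

(** By Binet's formula this is [subXX_growth] for [x ^+ m] and [y ^+ m]; [m0] is chosen so that
    [|x| ^+ m] reaches [4 * r ^ 2]. *)
Lemma lucas_growth r : (1 < r)%N -> `|y| <= `|x| -> exists m0, forall m,
  (m0 <= m)%N -> (0 < m)%N ->
  r%:Z * `|u m| < `|u (m * r)|
  \/ r%:Z * `|u (m * r)| < `|u (m * r * r)|.
Proof.
move=> r_gt1 yx.
have [m0 m0P] := unbounded_expr (root_gt1 yx) (ler0n algC (4 * r ^ 2)).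
have normu m : `|(u m)|%:~R * `|x - y| = `|x ^+ m - y ^+ m|.
  by rewrite intr_norm -normrM (lucas_binet m lucas_u sum_xy prod_xy).
have d_gt0 : 0 < `|x - y|.
  by rewrite normr_gt0 subr_eq0 -[x]expr1 -[y]expr1 xy_neq.
exists m0 => m m0m m_gt0; case: ltP => [|le]; [by left|right].
rewrite -(@ltr_int algC) rmorphM /= -(ltr_pM2r d_gt0) -mulrA !normu.
rewrite -mulnA !(exprM _ m) subXX_growth //.
- by rewrite !normrX lerXn2r ?nnegrE.
- by rewrite normrX m0P.
- by rewrite -!exprM xy_neq // muln_gt0 m_gt0 ltnW.
rewrite -!exprM -!normu -[r%:R]/(r%:Z%:~R) mulrA ler_pM2r // -rmorphM.
by rewrite ler_int.
Qed.

End Growth.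

(** * Chains of primes and the count of their products *)

Lemma logn_prod (I : Type) (s : seq I) (F : I -> nat) p :
  (forall i, (0 < F i)%N) ->
  logn p (\prod_(i <- s) F i)%N = (\sum_(i <- s) logn p (F i))%N.
Proof.
move=> F_gt0; elim: s => [|i s IH]; first by rewrite !big_nil logn1.
by rewrite !big_cons lognM ?IH // prodn_gt0.
Qed.

Lemma prime_prod_inj (I : finType) (q : I -> nat) E :
  (forall i, prime (q i)) -> injective q ->
  injective (fun e : {ffun I -> 'I_E} => \prod_i q i ^ e i)%N.
Proof.
move=> q_prime q_inj e f /= Eef; apply/ffunP => i; apply/val_inj => /=.
have logE (g : {ffun I -> 'I_E}) : logn (q i) (\prod_j q j ^ g j)%N = g i.
  rewrite logn_prod => [|j]; last by rewrite expn_gt0 prime_gt0.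
  rewrite (bigD1 i) //= lognX logn_prime // eqxx muln1 big1 ?addn0 // => j ji.
  by rewrite lognX logn_prime // (inj_eq q_inj) eq_sym (negPf ji) muln0.
by rewrite -logE Eef logE.
Qed.

Lemma sum_expn_le R K : (1 < R)%N -> (\sum_(i < K) R ^ i.+1 <= 2 * R ^ K)%N.
Proof.
move=> R_gt1; elim: K => [|K IH]; first by rewrite big_ord0.
rewrite big_ord_recr /= mul2n -addnn leq_add2r (leq_trans IH) // expnS.
by rewrite leq_mul2r R_gt1 orbT.
Qed.

Lemma prime_discr_exists (a1 a2 : int) :
  lucas_discr a1 a2 != 1 -> lucas_discr a1 a2 != 0 ->
  exists2 r : nat, prime r & (r%:Z %| lucas_discr a1 a2)%Z.
Proof.
move=> d1 d0; exists (pdiv `|lucas_discr a1 a2|).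
  (* The value -1 is excluded because a discriminant is 0 or 1 modulo 4. *)
  apply: pdiv_prime; suff : lucas_discr a1 a2 != -1 by lia.
  apply/eqP => dN1; have : a1 ^+ 2 = -1 - 4 * a2.
    by rewrite -dN1 /lucas_discr; ring.
  have [k [->|->]] : exists k, a1 = 2 * k \/ a1 = 2 * k + 1.
  - by exists (a1 %/ 2)%Z; lia.
  - by have -> : (2 * k) ^+ 2 = 4 * k ^+ 2 by [ring]; lia.
  - by have -> : (2 * k + 1) ^+ 2 = 4 * (k ^+ 2 + k) + 1 by [ring]; lia.
by rewrite dvdzE /= pdiv_dvd.
Qed.

Section Counting.

Variables (a1 a2 : int) (u : nat -> int).
Hypothesis lucas_u : lucas_seq a1 a2 u.
Hypothesis coprime_a : gcdz a1 a2 = 1.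
Hypothesis u_neq0 : forall m, (0 < m)%N -> u m != 0.

Lemma self_dvd_prod (I : Type) (s : seq I) (q e : I -> nat) n :
  (n%:Z %| u n)%Z -> (forall i, ((q i)%:Z %| u n)%Z) ->
  ((n * \prod_(i <- s) q i ^ e i)%N%:Z %| u (n * \prod_(i <- s) q i ^ e i))%Z.
Proof.
move=> dvd_n dvd_q; elim: s => [|i s IH]; first by rewrite big_nil muln1.
rewrite big_cons mulnCA mulnC; move: (\prod_(j <- s) _)%N IH => P IH.
elim: (e i) => [|k IHk]; first by rewrite expn0 muln1.
rewrite expnSr mulnA; apply: (self_dvd_mul lucas_u IHk).
by apply: dvdz_trans (dvd_q i) _; rewrite -mulnA;
  exact: (lucas_dvd_muln lucas_u).
Qed.

Section PrimeChain.

Variable r : nat.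
Hypotheses (r_prime : prime r) (r_discr : (r%:Z %| lucas_discr a1 a2)%Z).
Variable m0 : nat.
Hypothesis growth : forall m, (m0 <= m)%N -> (0 < m)%N ->
  r%:Z * `|u m| < `|u (m * r)| \/ r%:Z * `|u (m * r)| < `|u (m * r * r)|.

(** The new prime appears either from [r ^ i] to [r ^ i.+1] or from there to [r ^ i.+2]. Both cases
    fit in a double step, which is why the chain runs over powers of [r ^ 2]. *)
Lemma new_prime_step i : (m0 <= r ^ i)%N -> (1 < i)%N ->
  exists p : nat, [&& prime p, (p%:Z %| u (r ^ i.+2))%Z
    & ~~ (p%:Z %| u (r ^ i))%Z].
Proof.
move=> m0i i_gt1; have ri_gt0 k : (0 < r ^ k)%N by rewrite expn_gt0 prime_gt0.
have step k : (1 < k)%N -> r%:Z * `|u (r ^ k)| < `|u (r ^ k * r)| ->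
    exists p : nat, [/\ prime p, (p%:Z %| u (r ^ k * r))%Z
      & ~~ (p%:Z %| u (r ^ k))%Z].
  move=> k_gt1; apply: (lucas_new_prime lucas_u) => //.
  - exact: (expn_self_dvd lucas_u).
  - by rewrite dvdn_exp2l.
  - exact: u_neq0.
case: (growth m0i (ri_gt0 i)) => [/(step _ i_gt1)|].
  move=> [p [p_prime pu pnu]]; exists p; apply/and3P; split=> //.
  apply: dvdz_trans pu _; rewrite -addn2 expnD expnS mulnA.
  exact: (lucas_dvd_muln lucas_u).
rewrite -expnSr => /(step _ (leqW i_gt1)) [p [p_prime pu pnu]].
exists p; apply/and3P; split=> //; first by rewrite expnSr.
apply: contra pnu => /dvdz_trans; apply.
by rewrite expnSr; exact: (lucas_dvd_muln lucas_u).
Qed.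

Lemma prime_chain : exists q : nat -> nat, exists j0 : nat, forall j,
  (j0 <= j)%N ->
  [/\ prime (q j), ((q j)%:Z %| u ((r ^ 2) ^ j.+1))%Z
    & ~~ ((q j)%:Z %| u ((r ^ 2) ^ j))%Z].
Proof.
(* The implication makes existence hold for every [j], so that [xchoose] yields a total function. *)
have ex j : exists p : nat, (m0 + 1 <= j)%N ==>
   [&& prime p, (p%:Z %| u ((r ^ 2) ^ j.+1))%Z
     & ~~ (p%:Z %| u ((r ^ 2) ^ j))%Z].
  have [le_j|] := leqP (m0 + 1) j; last by exists 0%N.
  rewrite -!expnM mulnS; apply: new_prime_step; last by lia.
  apply: leq_trans (ltnW (ltn_expl _ (prime_gt1 r_prime))); lia.
exists (fun j => xchoose (ex j)), (m0 + 1)%N => j le_j.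
by have /implyP/(_ le_j)/and3P := xchooseP (ex j).
Qed.

Lemma self_dvd_count : a2 != 0 -> exists R D : nat, [/\ (1 < R)%N, (1 < D)%N &
  forall K X : nat, (D ^ R ^ (2 * K) <= X)%N ->
    (R ^ (K * K) <= #|[set n : 'I_X.+1 | (0 < n)%N && (n%:Z %| u n)%Z]|)%N].
Proof.
move=> a2_neq0; have [q [j0 q_spec]] := prime_chain.
set R := (r ^ 2)%N in q_spec.
have R_gt1 : (1 < R)%N by rewrite -(expn0 r) ltn_exp2l ?prime_gt1.
set C := (1 + `|a1| + `|a2|)%N.
have C_gt1 : (1 < C)%N by rewrite /C; lia.
(* In the exponent of [C], the factor [N] costs at most [R ^ j0 * R ^ K] and the primes at most
   [2 * R ^ j0 * R ^ (2 * K)]; hence the 3. *)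
exists R, (C ^ (3 * R ^ j0))%N; split=> // [|K X X_ge].
  by rewrite -(expn0 C) ltn_exp2l // muln_gt0 expn_gt0 (ltnW R_gt1).
(* The exponent [j0 + K] makes each of the [K] primes divide [u N]. *)
pose N := (R ^ (j0 + K))%N; pose E := (R ^ K)%N.
pose g (e : {ffun 'I_K -> 'I_E}) := (N * \prod_(i < K) q (j0 + i) ^ e i)%N.
have q_prime (i : 'I_K) : prime (q (j0 + i)).
  by have [] := q_spec (j0 + i)%N (leq_addr _ _).
have q_dvd i k : (j0 <= i < k)%N -> ((q i)%:Z %| u (R ^ k))%Z.
  case/andP => j0i ik; have [_ qu _] := q_spec i j0i.
  by apply: dvdz_trans qu _; rewrite -(subnKC ik) expnD;
    exact: (lucas_dvd_muln lucas_u).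
(* The earlier prime divides [u (R ^ j)] while [q j] does not. *)
have q_lt i j : (j0 <= i < j)%N -> q i != q j.
  move=> ij; have /q_spec[_ _] : (j0 <= j)%N by lia.
  by apply: contraNneq => <-; apply: q_dvd.
have q_inj : injective (fun i : 'I_K => q (j0 + i)%N).
  move=> i j /= Eij; apply/val_inj; case: (ltngtP i j) => // lt_ij.
    by have /eqP[] : q (j0 + i)%N != q (j0 + j)%N by apply: q_lt; lia.
  by have /eqP[] : q (j0 + j)%N != q (j0 + i)%N by apply: q_lt; lia.
have N_gt0 : (0 < N)%N by rewrite expn_gt0 ltnW.
have g_inj : injective g.
  move=> e f /eqP; rewrite eqn_pmul2l // => /eqP.
  exact: (prime_prod_inj q_prime q_inj).
have g_dvd e : ((g e)%:Z %| u (g e))%Z.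
  apply: self_dvd_prod => [|i].
    by rewrite /N -expnM; exact: (expn_self_dvd lucas_u).
  by apply: q_dvd; have := ltn_ord i; lia.
have g_gt0 e : (0 < g e)%N.
  rewrite muln_gt0 N_gt0 prodn_gt0 // => i.
  by rewrite expn_gt0 prime_gt0.
have q_le (i : 'I_K) : (q (j0 + i) <= C ^ R ^ (j0 + i).+1)%N.
  have [q_pr qu _] := q_spec (j0 + i)%N (leq_addr _ _).
  have Rgt0 : (0 < R ^ (j0 + i).+1)%N by rewrite expn_gt0 ltnW.
  apply: (@leq_trans `|u (R ^ (j0 + i).+1)|%N).
    by apply: dvdn_leq; rewrite ?absz_gt0 ?u_neq0 // -[q _]/(`|(q _)%:Z|%N)
      -dvdzE.
  rewrite -lez_nat abszE; apply: le_trans (lucas_bound lucas_u _) _.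
  by rewrite -[(C ^ _)%N%:Z]natz natrX natz.
have g_le e : (g e <= X)%N.
  apply: leq_trans X_ge; rewrite /g.
  have N_le : (N <= C ^ N)%N by exact/ltnW/ltn_expl.
  have prod_le : (\prod_(i < K) q (j0 + i) ^ e i <= C ^ (E * R ^ j0 * (2 * R ^
    K)))%N.
    apply: (@leq_trans (\prod_(i < K) C ^ (E * R ^ j0 * R ^ i.+1))).
      apply: leq_prod => i _; rewrite -mulnA -expnD addnS mulnC expnM.
      apply: (@leq_trans (q (j0 + i) ^ E)).
        by rewrite leq_pexp2l ?prime_gt0 // ltnW.
      by rewrite leq_exp2r // expn_gt0 ltnW.
    by rewrite -expn_sum -big_distrr leq_exp2l // leq_mul2l sum_expn_le ?orbT.
  apply: leq_trans (leq_mul N_le prod_le) _; rewrite -expnD -expnM leq_exp2l //.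
  rewrite /N /E expnD [(2 * K)%N]mul2n -addnn expnD.
  have : (0 < R ^ K)%N by rewrite expn_gt0 ltnW.
  move: (R ^ K)%N (R ^ j0)%N => S T S_gt0.
  have : (T * S <= T * S * S)%N by rewrite leq_pmulr.
  lia.
pose h e : 'I_X.+1 := inord (g e).
have hE e : h e = g e :> nat by rewrite inordK // ltnS.
have h_inj : injective h.
  by move=> e f /(congr1 val) /=; rewrite !hE => /g_inj.
have -> : (R ^ (K * K) = #|h @: [set: {ffun 'I_K -> 'I_E}]|)%N.
  by rewrite card_imset // cardsT card_ffun !card_ord expnM.
apply/subset_leq_card/subsetP => _ /imsetP[e _ ->].
by rewrite inE hE g_gt0 g_dvd.
Qed.

End PrimeChain.
End Counting.

(** * Passage from powers to iterated logarithms *)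

Lemma expR_ln_ln_lower_bound (R : realType) (b D : nat) (f : nat -> nat) :
  (1 < b)%N -> (1 < D)%N ->
  (forall K X, (D ^ b ^ (2 * K) <= X)%N -> (b ^ (K * K) <= f X)%N) ->
  exists c x0 : R, [/\ 0 < c, 0 < x0 & forall x : R, x0 < x ->
    expR (c * ln (ln x) ^+ 2) < (f (Num.truncn x))%:R].
Proof.
move=> b_gt1 D_gt1 f_ge.
have T_gt0 : 0 < ln b%:R :> R by rewrite ln_gt0 // ltr1n.
have d_gt0 : 0 < ln D%:R :> R by rewrite ln_gt0 // ltr1n.
set T : R := ln b%:R in T_gt0; set d : R := ln D%:R in d_gt0.
(* The term [2 * |ln d|] gives [l / 2 + ln d <= l], needed for [X_le]; the term [8 * T] gives
   [l < 8 * T * K%:R] despite the truncation in [K]. Squaring the latter produces the constant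
   [64 * T]. *)
pose l0 := 8 * T + 2 * `|ln d|.
exists (64 * T)^-1, (expR (expR l0)); split=> [||x x_gt].
- by rewrite invr_gt0 mulr_gt0.
- exact: expR_gt0.
have x_gt0 : 0 < x by apply: lt_trans x_gt; exact: expR_gt0.
have L_gt : expR l0 < ln x by rewrite -[ltLHS]expRK ltr_ln ?posrE ?expR_gt0.
have L_gt0 : 0 < ln x by apply: lt_trans L_gt; exact: expR_gt0.
have l_gt : l0 < ln (ln x) by rewrite -[ltLHS]expRK ltr_ln ?posrE ?expR_gt0.
set l := ln (ln x) in l_gt *.
have d_ge0 : 0 <= `|ln d| by [].
have l_ge0 : 0 <= l by rewrite /l0 in l_gt; lra.
pose K := Num.truncn (l / (4 * T)).
have T4 : 0 < 4 * T by lra.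
have /andP[K_le K_gt] : K%:R <= l / (4 * T) < K.+1%:R.
  by apply: truncn_itv; rewrite divr_ge0 // ltW.
rewrite ler_pdivlMr // in K_le; rewrite ltr_pdivrMr // in K_gt.
have X_le : (D ^ b ^ (2 * K) <= Num.truncn x)%N.
  rewrite truncn_ge_nat ?(ltW x_gt0) // -ler_ln ?posrE ?ltr0n ?expn_gt0 ?(ltnW
    D_gt1) //.
  rewrite natrX lnXn ?ltr0n ?(ltnW D_gt1) // -[ln _ *+ _]mulr_natl -/d.
  have bK_gt0 : 0 < (b ^ (2 * K))%:R :> R by rewrite ltr0n expn_gt0 ltnW.
  rewrite -ler_ln ?posrE ?mulr_gt0 // lnM ?posrE // -/l natrX lnXn ?ltr0n
    ?(ltnW b_gt1) //.
  rewrite -[ln _ *+ _]mulr_natl -/T natrM.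
  move: (ler_norm (ln d)) K_le l_gt d_ge0 T_gt0; rewrite /l0; clearbody T d l K.
  by move: K%:R (ln d) `|ln d| => k e e'; clear; lra.
apply: lt_le_trans (_ : (b ^ (K * K))%:R <= _); last by rewrite ler_nat f_ge.
rewrite natrX -[b%:R]lnK ?posrE ?ltr0n ?(ltnW b_gt1) // -/T -expRM_natl
  ltr_expR natrM.
have lK : l < 8 * T * K%:R.
  move: K_gt l_gt d_ge0; rewrite -natr1 /l0; clearbody T d l K.
  by move: K%:R `|ln d| => k e; clear; lra.
rewrite mulrC ltr_pdivrMr ?mulr_gt0 //.
have -> : K%:R * K%:R * T * (64 * T) = (8 * T * K%:R) ^+ 2 by ring.
by rewrite ltrXn2r // nnegrE // (le_trans l_ge0) // ltW.
Qed.

Theorem theorem4 (R : realType) (a1 a2 : int) (u : nat -> int)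
    (alpha1 alpha2 : algC)
    (a2_neq0 : a2 != 0)
    (coprime_a : gcdz a1 a2 = 1)
    (lucas_u : lucas_seq a1 a2 u)
    (roots_alpha : map_poly (intr : int -> algC) (lucas_charpoly a1 a2)
                   = ('X - alpha1%:P) * ('X - alpha2%:P))
    (alpha_distinct : alpha1 != alpha2)
    (alpha_ratio : forall k : nat, (0 < k)%N ->
                     ~~ k.-unity_root (alpha1 / alpha2))
    (discr_neq1 : lucas_discr a1 a2 != 1) :
  exists c1 x0 : R, [/\ 0 < c1, 0 < x0
    & forall x : R, x0 < x ->
        expR (c1 * (ln (ln x)) ^+ 2) < (count_self_dvd u x)%:R].
Proof.
have [sum_xy prod_xy] := lucas_roots roots_alpha.
have alpha2_neq0 : alpha2 != 0.
  apply: contraNneq a2_neq0 => E; have := prod_xy.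
  by rewrite E mulr0 => /eqP; rewrite eq_sym oppr_eq0 intr_eq0.
have xy_neq k : (0 < k)%N -> alpha1 ^+ k != alpha2 ^+ k.
  move=> /alpha_ratio; apply: contra => /eqP E.
  by rewrite unity_rootE expr_div_n E divff // expf_neq0.
have discr_neq0 : lucas_discr a1 a2 != 0.
  rewrite -(@intr_eq0 algC) (_ : _%:~R = (alpha1 - alpha2) ^+ 2).
    by rewrite expf_eq0 /= subr_eq0.
  rewrite /lucas_discr rmorphD rmorphXn rmorphM /= -sum_xy -[a2%:~R]opprK
    -prod_xy.
  by ring.
have [r r_prime r_discr] := prime_discr_exists discr_neq1 discr_neq0.
have u_neq0 m : (0 < m)%N -> u m != 0.
  exact: (lucas_neq0 lucas_u sum_xy prod_xy xy_neq).
have [m0 growth] : exists m0, forall m, (m0 <= m)%N -> (0 < m)%N ->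
    r%:Z * `|u m| < `|u (m * r)| \/ r%:Z * `|u (m * r)| < `|u (m * r * r)|.
  have r_gt1 := prime_gt1 r_prime.
  (* The hypotheses are symmetric in the two roots, so the one of larger modulus can be put
     first. *)
  case/orP: (real_leVge (normr_real alpha2) (normr_real alpha1)) => le_norm.
    exact: (lucas_growth lucas_u a2_neq0 sum_xy prod_xy xy_neq r_gt1 le_norm).
  apply: (lucas_growth lucas_u a2_neq0 _ _ _ r_gt1 le_norm).
  - by rewrite addrC.
  - by rewrite mulrC.
  - by move=> k /xy_neq; rewrite eq_sym.
have [b [D [b_gt1 D_gt1 count_ge]]] :=
  self_dvd_count lucas_u coprime_a u_neq0 r_prime r_discr growth a2_neq0.
exact: (expR_ln_ln_lower_bound R b_gt1 D_gt1 count_ge).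
Qed.
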